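(* Let $f(x)\in\mathbb{Z}[x]$ be a monic polynomial all of whose (complex) roots are rational, and suppose that none of the coefficients of $x^0,x^1,\ldots,x^{\deg f}$ in $f$ is divisible by $5$. Then the base $5$ expansion of $\deg(f)+1$ has at most $4$ nonzero digits. *)

(* Defs.v *)
From mathcomp Require Import all_boot all_order all_algebra.

Set Implicit Arguments.
Unset Strict Implicit.
Unset Printing Implicit Defensive.

(* Least significant digit first; for 1 < b and 0 < n there is no spurious    *)
(* leading zero, since b ^ trunc_log b n <= n < b ^ (trunc_log b n).+1.       *)
Definition digits (b n : nat) : seq nat :=
  mkseq (fun i => (n %/ b ^ i) %% b) (trunc_log b n).+1.

Definition num_nonzero_digits (b n : nat) : nat :=
  count (fun d => d != 0) (digits b n).

Lemma digits_lt (b n : nat) : 1 < b -> all (fun d => d < b) (digits b n).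
Proof. by move=> b1; apply/allP=> d /mapP[i _ ->]; rewrite ltn_mod ltnW. Qed.

Lemma digits_sum (b n : nat) : 1 < b ->
  \sum_(i < size (digits b n)) nth 0 (digits b n) i * b ^ i = n.
Proof.
move=> b1; have b0 := ltnW b1; rewrite size_mkseq.
have key k : \sum_(i < k) ((n %/ b ^ i) %% b) * b ^ i = n %% b ^ k.
  elim: k => [|k IHk]; first by rewrite big_ord0 modn1.
  rewrite big_ord_recr /= IHk.
  have e : n = n %/ b ^ k.+1 * b ^ k.+1
               + ((n %/ b ^ k) %% b * b ^ k + n %% b ^ k).
    rewrite addnA expnSr divnMA [b ^ k * b]mulnC mulnA -mulnDl.
    by rewrite -!divn_eq.
  have := e; rewrite {1}(divn_eq n (b ^ k.+1)) => /addnI ->.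
  by rewrite addnC.
rewrite -[RHS](modn_small (trunc_log_ltn n b1)) -key.
by apply: eq_bigr => i _; rewrite nth_mkseq.
Qed.

(* Main.v *)
Require Import Defs.
From HB Require Import structures.
From mathcomp Require Import all_boot all_order all_algebra.
From mathcomp Require Import reals complex.
From mathcomp Require Import zify.

Set Implicit Arguments.
Unset Strict Implicit.
Unset Printing Implicit Defensive.

Import GRing.Theory.

(** Modulo 5 the polynomial f is a product F of factors X + b with b in
{1, 2, 3, 4}, all of whose coefficients are nonzero. Reducing the exponents
modulo 5 gives F = h F'^5 = h F'(X^5) with h of degree at most 16, so the
coefficients of g F in a fixed residue class modulo 5 are those of g_i F',
where g_i is the corresponding section of g h, and the last base 5 digit of
deg F + 1 is that of deg h + 1. Starting from g = 1 and iterating, one follows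
a finite set G of polynomials of degree at most 4, up to scalars, such that
g F has only nonzero coefficients for every g in G, while deg F shrinks. Only
finitely many triples (G, offset, number of nonzero digits already read) are
reachable, 424 in all, and on none of them does the digit count exceed 4. *)

(** * Arithmetic modulo 5 and coefficient lists *)

(* The residues modulo 5 as an enumeration, since [vm_compute] and the kernel
   compute much faster on it than on 'F_5. *)
Variant F5 := Z0 | Z1 | Z2 | Z3 | Z4.

Definition F5_to_nat (a : F5) : nat :=
  match a with Z0 => 0 | Z1 => 1 | Z2 => 2 | Z3 => 3 | Z4 => 4 end.

Definition nat_to_F5 (n : nat) : F5 := nth Z0 [:: Z0; Z1; Z2; Z3; Z4] n.

Lemma F5_to_natK : cancel F5_to_nat nat_to_F5. Proof. by case. Qed.

HB.instance Definition _ := Equality.copy F5 (can_type F5_to_natK).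

Definition succ5 (a : F5) : F5 :=
  match a with Z0 => Z1 | Z1 => Z2 | Z2 => Z3 | Z3 => Z4 | Z4 => Z0 end.

Definition add5 (a b : F5) : F5 :=
  match a with
  | Z0 => b
  | Z1 => succ5 b
  | Z2 => succ5 (succ5 b)
  | Z3 => succ5 (succ5 (succ5 b))
  | Z4 => succ5 (succ5 (succ5 (succ5 b)))
  end.

Definition mul5 (a b : F5) : F5 :=
  match a with
  | Z0 => Z0
  | Z1 => b
  | Z2 => add5 b b
  | Z3 => add5 b (add5 b b)
  | Z4 => add5 b (add5 b (add5 b b))
  end.

Definition nonzero5 (a : F5) : bool := if a is Z0 then false else true.

Fixpoint conv_coef (g h : seq F5) (k : nat) : F5 :=
  if g is a :: g' then
    add5 (mul5 a (nth Z0 h k)) (if k is k'.+1 then conv_coef g' h k' else Z0)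
  else Z0.

(* [all] and [&&] are strict under call-by-value, and most tests below fail at
   once; hence the nested conditionals here and in [alive]. *)
Fixpoint all_lazy (T : Type) (a : pred T) (s : seq T) : bool :=
  if s is x :: s' then if a x then all_lazy a s' else false else true.

Definition conv (g h : seq F5) : seq F5 :=
  mkseq (conv_coef g h) (size g + size h).-1.

(** The length is the number of [k] with [5 * k + i < size p]; truncated subtraction makes it 0 when
    [size p <= i]. *)
Definition section (p : seq F5) (i : nat) : seq F5 :=
  mkseq (fun k => nth Z0 p (5 * k + i)) ((size p - i + 4) %/ 5).

Definition normalize (p : seq F5) : seq F5 :=
  (* a ^ 3 is the inverse of a nonzero a *)
  let a := head Z0 p in [seq mul5 (mul5 a (mul5 a a)) x | x <- p].

(* The first and last five coefficients of g h are the extreme coefficients of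
   its five sections: they must be nonzero for some g h F'(X^5) to be full. *)
Definition alive (g h : seq F5) : bool :=
  let n := size g + size h - 1 in
  all_lazy (fun k =>
      if nonzero5 (conv_coef g h k) then nonzero5 (conv_coef g h (n - k.+1))
      else false)
    (iota 0 (minn 5 n)).

(** * The finite search *)

Definition digit_polys : seq (seq F5) :=
  foldr (fun b hs => [seq iter r (conv [:: b; Z1]) h | r <- iota 0 5, h <- hs])
    [:: [:: Z1]] [:: Z1; Z2; Z3; Z4].

Fixpoint lex_le (p q : seq F5) : bool :=
  match p, q with
  | [::], _ => true
  | _, [::] => false
  | a :: p', b :: q' => (F5_to_nat a < F5_to_nat b) || ((a == b) && lex_le p' q')
  end.

(* A state (G, e, c) stands for the claim that c plus the number of nonzero
   digits of e + deg F is at most 4 whenever g F is full for all g in G. *)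
Definition state : Type := (seq (seq F5) * nat * nat)%type.

(** Normalizing, sorting and removing duplicates give a set of polynomials up to scalars one
    representative, so that [closure] recognizes the states already seen. *)
Definition next_polys (G : seq (seq F5)) (h : seq F5) : seq (seq F5) :=
  sort lex_le
    (undup [seq normalize (section (conv g h) i) | g <- G, i <- iota 0 5]).

Definition successors H (s : state) : seq state :=
  let: (G, e, c) := s in
  pmap (fun h =>
    if all_lazy (fun g => alive g h) G then
      let d := e + (size h).-1 in
      Some (next_polys G h, d %/ 5, c + (d %% 5 != 0))
    else None) H.

Fixpoint closure H (n : nat) (front seen : seq state) : option (seq state) :=
  if front is [::] then Some seen else
  if n is n'.+1 then
    let new := undup [seq t <- flatten (map (successors H) front) | t \notin seen] in
    closure H n' new (new ++ seen)
  else None.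

(** The offset 1 is there because the digits counted are those of deg F + 1. *)
Definition initial : state := ([:: [:: Z1]], 1, 0).

Definition bounded (s : state) : bool :=
  s.2 + num_nonzero_digits 5 s.1.2 <= 4.

Local Open Scope ring_scope.

(** * Coefficient lists as polynomials over the field with 5 elements *)

Definition F5_val (a : F5) : 'F_5 := (F5_to_nat a)%:R.

Lemma F5_valD a b : F5_val (add5 a b) = F5_val a + F5_val b.
Proof. by case: a; case: b; apply/eqP. Qed.

Lemma F5_valM a b : F5_val (mul5 a b) = F5_val a * F5_val b.
Proof. by case: a; case: b; apply/eqP. Qed.

Lemma nonzero5E a : nonzero5 a = (F5_val a != 0).
Proof. by case: a. Qed.

Lemma F5_val_onto (x : 'F_5) : exists b, F5_val b = x.
Proof.
exists (nat_to_F5 x); apply/eqP.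
by case: x => [[|[|[|[|[|k]]]]] lt_k].
Qed.

Definition pol (p : seq F5) : {poly 'F_5} := \poly_(i < size p) F5_val (nth Z0 p i).

Lemma coef_pol p i : (pol p)`_i = F5_val (nth Z0 p i).
Proof. by rewrite coef_poly; case: ltnP => // le_p; rewrite nth_default. Qed.

Lemma pol_nil : pol [::] = 0.
Proof. by apply/polyP=> i; rewrite coef_pol nth_nil coef0. Qed.

Lemma size_pol p : (size (pol p) <= size p)%N.
Proof. exact: size_poly. Qed.

Lemma pol_cons a p : pol (a :: p) = (F5_val a)%:P + 'X * pol p.
Proof.
by apply/polyP=> -[|i]; rewrite coefD coefC coefXM !coef_pol /= ?addr0 ?add0r.
Qed.

Lemma conv_coefE g h k : F5_val (conv_coef g h k) = (pol g * pol h)`_k.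
Proof.
elim: g k => [|a g IHg] k /=.
  by rewrite pol_nil mul0r coef0.
rewrite pol_cons mulrDl coefD coefCM -mulrA coefXM coef_pol F5_valD F5_valM.
by case: k => [|k] //=; rewrite IHg.
Qed.

Lemma pol_conv g h : pol (conv g h) = pol g * pol h.
Proof.
apply/polyP=> k; rewrite coef_pol; have [lt_k | le_k] := ltnP k (size g + size h).-1.
  by rewrite nth_mkseq // conv_coefE.
rewrite nth_default ?size_mkseq // nth_default //.
apply: leq_trans (size_polyMleq _ _) (leq_trans _ le_k).
by have := size_pol g; have := size_pol h; lia.
Qed.

Lemma nth_section p i k : (i < 5)%N -> nth Z0 (section p i) k = nth Z0 p (5 * k + i).
Proof.
move=> lt_i5; have [lt_k | le_k] := ltnP k ((size p - i + 4) %/ 5).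
  by rewrite nth_mkseq.
by rewrite !nth_default ?size_mkseq //; lia.
Qed.

(** * Frobenius and sections *)

(** Frobenius is additive in characteristic p and fixes the coefficients, which are images of
    natural numbers. *)
Lemma exprFp_comp p (q : {poly 'F_p}) : prime p -> q ^+ p = q \Po 'X^p.
Proof.
move=> p_pr; have chp : p \in [pchar {poly 'F_p}] by rewrite pchar_poly pchar_Fp.
rewrite -(pFrobenius_autE chp) -{1}[q]coefK poly_def comp_polyE raddf_sum.
apply: eq_bigr => i _; rewrite /= pFrobenius_autE exprZn exprAC; congr (_ *: _).
by rewrite -[q`_i]natr_Zp -(pFrobenius_autE (pchar_Fp p_pr)) pFrobenius_aut_nat.
Qed.

(** All exponents of [q ^+ 5], that is of q(X^5), are multiples of 5, so the exponents congruent to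
    [i] in the product only see section [i] of [p]. *)
Lemma coef_section p (q : {poly 'F_5}) k i : (i < 5)%N ->
  (pol p * q ^+ 5)`_(5 * k + i) = (pol (section p i) * q)`_k.
Proof.
move=> lt_i5; rewrite exprFp_comp // comp_polyE -[in RHS](coefK q) poly_def.
rewrite !mulr_sumr !coef_sum.
apply: eq_bigr => l _; rewrite -!scalerAr !coefZ -exprM !coefMXn; congr (_ * _).
have -> : (5 * k + i < 5 * l)%N = (k < l)%N by lia.
case: ltnP => // le_lk; rewrite !coef_pol nth_section //.
by congr (F5_val (nth _ _ _)); lia.
Qed.

(** * Products of the factors X + b *)

Definition units5 : seq F5 := [:: Z1; Z2; Z3; Z4].

Definition unitprod (m : F5 -> nat) : {poly 'F_5} :=
  \prod_(b <- units5) ('X + (F5_val b)%:P) ^+ m b.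

Definition total (m : F5 -> nat) : nat := \sum_(b <- units5) m b.

Lemma unitprod_monic m : unitprod m \is monic.
Proof.
apply: monic_prod => b _; apply: monic_exp; exact: monicXaddC.
Qed.

Lemma size_exp_XaddC (c : 'F_5) n : size (('X + c%:P) ^+ n) = n.+1.
Proof. by rewrite -[c]opprK polyCN size_exp_XsubC. Qed.

Lemma size_unitprod m : size (unitprod m) = (total m).+1.
Proof.
rewrite /unitprod /total; elim: units5 => [|b bs IH].
  by rewrite !big_nil size_poly1.
rewrite !big_cons size_Mmonic ?IH.
- by rewrite size_exp_XaddC addSn addnS.
- by rewrite -size_poly_gt0 size_exp_XaddC.
by apply: monic_prod => c _; apply: monic_exp; exact: monicXaddC.
Qed.

Lemma unitprod0 m : (unitprod m)`_0 != 0.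
Proof.
rewrite /unitprod -horner_coef0 horner_prod prodf_seq_neq0.
by apply/allP=> b; rewrite !inE => /or4P[]/eqP-> /=;
   rewrite horner_exp hornerD hornerX hornerC add0r expf_neq0.
Qed.

Lemma unitprod_divn m :
  unitprod m = unitprod (fun b => m b %% 5)%N * unitprod (fun b => m b %/ 5)%N ^+ 5.
Proof.
rewrite /unitprod -prodrXl -big_split /=; apply: eq_bigr => b _.
by rewrite -exprM -exprD addnC -divn_eq.
Qed.

Lemma total_divn m :
  total m = (total (fun b => m b %% 5) + 5 * total (fun b => m b %/ 5))%N.
Proof.
rewrite /total big_distrr -big_split /=; apply: eq_bigr => b _.
by rewrite addnC mulnC -divn_eq.
Qed.

(** * Polynomials without zero coefficients *)

Definition full (n : nat) (q : {poly 'F_5}) : Prop := forall k, (k < n)%N -> q`_k != 0.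

Lemma full_section p m i : (i < 5)%N ->
    full (size p + 5 * total m) (pol p * unitprod m ^+ 5) ->
  full (size (section p i) + total m) (pol (section p i) * unitprod m).
Proof.
move=> lt_i5 full_p k; rewrite size_mkseq => lt_k; rewrite -coef_section //.
by apply: full_p; lia.
Qed.

Lemma full_head p m n :
  (0 < n)%N -> full n (pol p * unitprod m) -> F5_val (head Z0 p) != 0.
Proof.
move=> n_gt0 /(_ 0%N n_gt0); rewrite coef0M coef_pol nth0 mulf_eq0.
by case/norP.
Qed.

Lemma full_normalize p m : full (size p + total m) (pol p * unitprod m) ->
  full (size (normalize p) + total m) (pol (normalize p) * unitprod m).
Proof.
move=> full_p k; rewrite size_map => lt_k.
(* The index [k] shows that the range is nonempty, so [full_p] also covers index 0 and the scaling
   factor is nonzero. *)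
have head_p := full_head (leq_ltn_trans (leq0n k) lt_k) full_p.
have -> : pol (normalize p) = F5_val (head Z0 p) ^+ 3 *: pol p.
  apply/polyP=> i; rewrite coefZ !coef_pol; have [lt_i|le_i] := ltnP i (size p).
    by rewrite (nth_map Z0) // !F5_valM -expr2 -exprS.
  by rewrite !nth_default ?size_map // mulr0.
by rewrite -scalerAl coefZ mulf_neq0 ?expf_neq0 ?full_p.
Qed.

Lemma all_lazyE (T : Type) (a : pred T) s : all_lazy a s = all a s.
Proof. by elim: s => //= x s ->; case: (a x). Qed.

Lemma full_alive g h m :
    full (size g + size h - 1 + 5 * total m) (pol g * pol h * unitprod m ^+ 5) ->
  alive g h.
Proof.
rewrite -pol_conv; set n := (size g + size h - 1)%N.
have size_p : size (conv g h) = n by rewrite size_mkseq /n; lia.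
move=> full_p; rewrite /alive -/n all_lazyE; apply/allP=> k.
rewrite mem_iota /= => lt_k.
have coefP j : (conv_coef g h j = nth Z0 (conv g h) j :> F5) \/ (n <= j)%N.
  by case: (ltnP j n) => [lt_j|]; [left; rewrite nth_mkseq //; lia | right].
rewrite !nonzero5E !conv_coefE -pol_conv.
have -> : (pol (conv g h))`_k != 0.
  have := full_p (5 * 0 + k)%N; rewrite coef_section; last by lia.
  rewrite coef0M !coef_pol nth_section; last by lia.
  by rewrite muln0 add0n mulf_eq0 => /(_ ltac:(lia))/norP[].
pose t := (n - k.+1)%N; pose i := (t %% 5)%N; pose j := (t %/ 5)%N.
have tE : t = (5 * j + i)%N by rewrite /i /j; lia.
have lt_i5 : (i < 5)%N by rewrite ltn_mod.
(* If coefficient [t] vanishes, section [i] has size at most [j]: its next entry would sit at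
   [t + 5], which is at least [n] because [k < 5]. Its product with [unitprod m] then has no term of
   degree [j + total m], against fullness. *)
apply/eqP=> p_t; have /eqP[] := full_p (5 * (j + total m) + i)%N ltac:(lia).
rewrite coef_section // nth_default //.
have size_s : (size (pol (section (conv g h) i)) <= j)%N.
  apply/leq_sizeP=> l; rewrite leq_eqVlt => /predU1P[<-|lt_jl].
    by rewrite coef_pol nth_section // -tE -coef_pol.
  by rewrite coef_pol nth_default // size_mkseq size_p; lia.
apply: leq_trans (size_polyMleq _ _) _; rewrite size_unitprod; lia.
Qed.

(** * Reading one digit *)

Definition digit_complete (H : seq (seq F5)) : Prop :=
  forall r : F5 -> nat, (forall b, r b < 5)%N ->
    exists2 h, h \in H & pol h = unitprod r /\ size h = (total r).+1.

Lemma digit_polys_complete : digit_complete digit_polys.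
Proof.
move=> r lt_r5; rewrite /digit_polys /unitprod /total -/units5.
elim: units5 => [|b bs [h h_in [hE size_h]]].
  exists [:: Z1]; rewrite ?inE // !big_nil; split=> //.
  by apply/polyP=> -[|i]; rewrite coef_pol coef1 //= nth_nil.
exists (iter (r b) (conv [:: b; Z1]) h).
  by apply: (allpairs_f (fun n p => iter n (conv [:: b; Z1]) p));
    rewrite ?mem_iota ?lt_r5.
rewrite !big_cons -hE; elim: (r b) => [|n [IHp IHs]].
  by rewrite expr0 mul1r add0n.
rewrite iterS pol_conv IHp exprS -mulrA; split.
  congr (_ * _); apply/polyP=> -[|[|i]]; rewrite coef_pol coefD coefX coefC /=;
    by rewrite ?nth_nil ?addr0 ?add0r.
by rewrite size_mkseq IHs.
Qed.

Lemma num_nonzero_digits_rec b n : (1 < b)%N ->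
  num_nonzero_digits b n = ((n %% b != 0) + num_nonzero_digits b (n %/ b))%N.
Proof.
move=> b_gt1; rewrite /num_nonzero_digits /digits.
have [lt_nb|le_bn] := ltnP n b.
  (* Here [n %/ b] is 0, and [digits b 0] is a single digit 0, which the count ignores. *)
  have /eqP-> : trunc_log b n == 0%N by rewrite trunc_log_eq0; lia.
  by rewrite divn_small // trunc_log0 /= !expn0 divn1 div0n mod0n.
have nb_gt0 : (0 < n %/ b)%N by rewrite divn_gt0 // ltnW.
have -> : trunc_log b n = (trunc_log b (n %/ b)).+1.
  apply: trunc_log_eq => //; have := trunc_log_bounds b_gt1 nb_gt0.
  by rewrite /= leq_divRL ?ltn_divLR -?expnSr // ltnW.
have mkseqSl k (F : nat -> nat) : mkseq F k.+1 = F 0%N :: mkseq (F \o succn) k.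
  by rewrite /mkseq -[iota 0 k.+1]/(0%N :: iota 1 k) (iotaDl 1 0) map_cons -map_comp.
rewrite mkseqSl -cat1s count_cat expn0 divn1.
congr addn; first by rewrite /= addn0.
by congr count; apply: eq_map => i /=; rewrite expnS divnMA.
Qed.

(** [size g] is a formal length, not deg g + 1: a trailing [Z0] in [g] makes the top required
    coefficient vanish and the condition false. *)
Definition full_with (G : seq (seq F5)) (m : F5 -> nat) : Prop :=
  forall g, g \in G -> full (size g + total m) (pol g * unitprod m).

(** With d = e + deg h and F' the product for the quotients, e + deg F = d + 5 deg F'. Hence
    [d %% 5] is the last digit and [d %/ 5] is the offset for the remaining ones. *)
Lemma successor_full H s m : digit_complete H -> full_with s.1.1 m ->
  exists2 t, t \in successors H s &
    full_with t.1.1 (fun b => m b %/ 5)%N /\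
    (t.2 + num_nonzero_digits 5 (t.1.2 + total (fun b => m b %/ 5)) =
     s.2 + num_nonzero_digits 5 (s.1.2 + total m))%N.
Proof.
move=> complete_H; case: s => [[G e] c] /= full_G; set q := fun b => (m b %/ 5)%N.
have [|h h_in [hE size_h]] := complete_H (fun b => m b %% 5)%N;
  first by move=> b; rewrite ltn_mod.
have full_gh g : g \in G ->
    full (size g + size h - 1 + 5 * total q) (pol g * pol h * unitprod q ^+ 5).
  move=> /full_G; rewrite unitprod_divn mulrA hE total_divn size_h -/q.
  by congr (full _ _); lia.
set d := (e + (size h).-1)%N.
exists (next_polys G h, d %/ 5, c + (d %% 5 != 0))%N.
  rewrite mem_pmap; apply/mapP; exists h => //.
  by rewrite all_lazyE (_ : all _ _) //; apply/allP=> g /full_gh/full_alive.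
split=> [p|/=].
  rewrite mem_sort mem_undup => /allpairsP[[g i] [gG i_in ->]].
  rewrite mem_iota /= in i_in gG *.
  apply: full_normalize; apply: full_section => //.
  by rewrite pol_conv size_mkseq -subn1; apply: full_gh.
rewrite [in RHS]num_nonzero_digits_rec // (total_divn m) -/q.
have dE : d = (e + total (fun b => m b %% 5))%N by rewrite /d size_h.
set x := (e + _)%N; have [-> ->] : (x %% 5 = d %% 5 /\ x %/ 5 = d %/ 5 + total q)%N.
  by rewrite /x dE; lia.
by rewrite addnA.
Qed.

(** * Closure of the search and the digit bound *)

(** The invariant is that only states in [front] may have successors outside [seen]; once the front
    is empty, [seen] is closed. *)
Lemma closureP H n front seen v : closure H n front seen = Some v ->
    {subset front <= seen} ->
    (forall s, s \in seen -> s \in front \/ {subset successors H s <= seen}) ->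
  {subset seen <= v} /\ forall s, s \in v -> {subset successors H s <= v}.
Proof.
elim: n front seen => [|n IHn] [|s0 front] seen //=.
- by move=> [<-] _ succ_seen; split=> // s /succ_seen[].
- by move=> [<-] _ succ_seen; split=> // s /succ_seen[].
set new := undup _ => /IHn{}IHn front_seen succ_seen.
have [||seen_v succ_v] := IHn.
- by move=> t t_new; rewrite mem_cat t_new.
- have succ_front s t : s \in s0 :: front -> t \in successors H s -> t \in new ++ seen.
    move=> s_front t_s; rewrite mem_cat mem_undup mem_filter; case: (t \in seen) => //=.
    rewrite orbF; apply/(@flattenP _ (map (successors H) (s0 :: front))).
    by exists (successors H s) => //; apply: (map_f (successors H) s_front).
  move=> s; rewrite mem_cat => /orP[s_new|/succ_seen[s_front|s_seen]].
  + by left.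
  + by right=> t; apply: succ_front.
  + by right=> t /s_seen; rewrite mem_cat orbC => ->.
by split=> // s s_seen; apply: seen_v; rewrite mem_cat s_seen orbT.
Qed.

(** Six rounds exhaust the reachable states; with too few rounds [closure] would return [None]. *)
Lemma closure_bounded :
  if closure digit_polys 6 [:: initial] [:: initial] is Some v then all bounded v
  else false.
Proof. by vm_compute. Qed.

Lemma full_unitprod_digits m : full (total m).+1 (unitprod m) ->
  (num_nonzero_digits 5 (total m).+1 <= 4)%N.
Proof.
move=> full_m; move: closure_bounded digit_polys_complete.
move: digit_polys => H closure_H complete_H; move: closure_H.
case E: (closure _ _ _ _) => [v|//] /allP bounded_v.
have [//||init_v succ_v] := closureP E; first by move=> s; left.
(* Induction on a bound for [total m']: dividing the exponents by 5 lowers a positive total, and at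
   total 0 the claim is [bounded s]. *)
suff main k s m' : (total m' < k)%N -> s \in v -> full_with s.1.1 m' ->
    (s.2 + num_nonzero_digits 5 (s.1.2 + total m') <= 4)%N.
  apply: (main (total m).+1 initial m) => //; first by rewrite init_v ?inE.
  move=> g; rewrite inE => /eqP->.
  suff -> : pol [:: Z1] = 1 by rewrite mul1r.
  by apply/polyP=> -[|i]; rewrite coef_pol coef1 //= nth_nil.
elim: k s m' {full_m} => // k IHk s m' lt_m'k s_v full_s.
have [->|m'_gt0] := posnP (total m'); first by rewrite addn0; apply: bounded_v.
have [t t_s [full_t <-]] := successor_full complete_H full_s.
apply: IHk => //; last exact: succ_v t_s.
by have := total_divn m'; lia.
Qed.

(** * From rational roots to linear factors modulo 5 *)

(** By Gauss's lemma the factor X - q of a rational root comes from an integer factor of [f]. As [f]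
    is monic, the leading coefficient of that factor is a unit, and rescaling gives X - a with a an
    integer; induction does the rest. *)
Lemma monic_split_of_rat_roots (C : numClosedFieldType) (f : {poly int}) :
    f \is monic ->
    (forall z : C, root (map_poly intr f) z -> exists q : rat, z = ratr q) ->
  exists s : seq int, f = \prod_(a <- s) ('X - a%:P).
Proof.
move: {2}(size f) (leqnn (size f)) => n.
elim: n f => [|n IHn] f le_fn f_monic f_roots.
  by move: le_fn; rewrite leqn0 size_poly_eq0 (negPf (monic_neq0 f_monic)).
have [size_f|size_f] := eqVneq (size f) 1.
  exists [::]; rewrite big_nil [f]size1_polyC ?size_f //.
  by move/monicP: f_monic; rewrite /lead_coef size_f => ->.
have [z fz0] : exists z : C, root (map_poly intr f) z.
  by apply/closed_rootP; rewrite size_map_inj_poly //; apply: intr_inj.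
have [q zE] := f_roots z fz0.
have fE_ratr : map_poly intr f = map_poly ratr (map_poly intr f) :> {poly C}.
  by rewrite -map_poly_comp; apply: eq_map_poly => a /=; rewrite ratr_int.
have : 'X - q%:P %| map_poly intr f.
  by move: fz0; rewrite zE fE_ratr fmorph_root -dvdp_XsubCl.
case/dvdpP_rat_int=> p [a a_neq0 pE] [r fE].
have size_p : size p = 2%N.
  by rewrite -(size_map_inj_poly (f := intr : int -> rat) intr_inj) //
    -(size_scale _ a_neq0) -pE size_XsubC.
set u := lead_coef p; set v := lead_coef r.
have uv1 : u * v = 1 by rewrite -lead_coefM -fE; apply/monicP.
have vpE : v *: p = 'X - (- (v *: p)`_0)%:P.
  apply/polyP=> -[|[|i]]; rewrite coefD coefN coefC coefX ?subr0 ?sub0r ?opprK //=.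
    by rewrite coefZ -uv1 mulrC /u /lead_coef size_p.
  by rewrite coefZ nth_default ?size_p // mulr0.
have fE' : f = (v *: p) * (u *: r).
  by rewrite -scalerAr -scalerAl scalerA uv1 scale1r.
have ur_monic : u *: r \is monic by apply/monicP; rewrite lead_coefZ.
have [|//|w rw0|s rE] := IHn (u *: r).
- rewrite -ltnS (leq_trans _ le_fn) // [in X in (_ < X)%N]fE' vpE.
  by rewrite size_Mmonic ?polyXsubC_eq0 // size_XsubC.
- by apply: f_roots; rewrite fE' rmorphM rootM rw0 orbT.
by exists (- (v *: p)`_0 :: s); rewrite big_cons -rE -vpE.
Qed.

Lemma unitprod_of_roots (s : seq 'F_5) : 0 \notin s ->
  exists2 m, \prod_(a <- s) ('X - a%:P) = unitprod m & total m = size s.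
Proof.
elim: s => [|a s IHs].
  by exists (fun=> 0%N); rewrite ?big_nil /unitprod /total ?big1.
rewrite inE negb_or big_cons => /andP[a_neq0 /IHs[m -> totalE]].
have [b bE] := F5_val_onto (- a); have b_unit : b \in units5.
  by case: b bE => // /eqP; rewrite eq_sym oppr_eq0 eq_sym (negPf a_neq0).
exists (fun c => (b == c) + m c)%N.
  rewrite /unitprod; under [RHS]eq_bigr => c _ do rewrite exprD.
  rewrite big_split /=; congr (_ * _); rewrite -polyCN -bE.
  by move: b_unit; rewrite !inE => /or4P[]/eqP->;
    rewrite !big_cons big_nil /= ?expr0 ?expr1 ?mulr1 ?mul1r.
rewrite /total big_split /= -add1n -totalE; congr (_ + _)%N.
by move: b_unit; rewrite !inE => /or4P[]/eqP->; rewrite !big_cons big_nil.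
Qed.

Theorem mainTheorem2 (R : realType) (f : {poly int})
  (f_monic : f \is monic)
  (f_roots : forall z : complex R,
     root (map_poly intr f : {poly complex R}) z -> exists q : rat, z = ratr q)
  (f_coefs : forall i : nat, (i <= (size f).-1)%N -> ~~ (5 %| f`_i)%Z) :
  (num_nonzero_digits 5 ((size f).-1 + 1) <= 4)%N.
Proof.
have [s fE] := monic_split_of_rat_roots f_monic f_roots.
have ch5 : 5%N \in [pchar 'F_5] by rewrite pchar_Fp.
have coefs_neq0 i : (i <= size s)%N -> (map_poly intr f : {poly 'F_5})`_i != 0.
  move=> le_is; rewrite coef_map /= -(dvdz_pcharf ch5) f_coefs //.
  by rewrite fE size_prod_XsubC.
have f5E : map_poly intr f = \prod_(a <- map intr s) ('X - a%:P) :> {poly 'F_5}.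
  rewrite fE rmorph_prod big_map; apply: eq_bigr => a _.
  by rewrite /= rmorphB /= map_polyX map_polyC.
(* The constant coefficient is nonzero modulo 5, so 0 is not among the reduced roots. *)
have [|m mE sizeE] := @unitprod_of_roots (map intr s).
  have := coefs_neq0 0%N (leq0n _); apply: contra => s0.
  by rewrite f5E -horner_coef0 -rootE root_prod_XsubC.
rewrite fE size_prod_XsubC addn1 /= -(size_map (intr : int -> 'F_5)) -sizeE.
apply: full_unitprod_digits => k; rewrite ltnS sizeE size_map -mE -f5E.
exact: coefs_neq0.
Qed.
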